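(* Let $\{X_t\}_{t\ge0}$ be a simple random walk on monotone increasing connected graphs $\{\mathbb{G}_t\}_{t\ge0}$, $\mathbb{G}_t\subseteq\overline{\mathbb{G}}$ (as defined in the context). Set $\eta_0:=0$ and, for $n\ge0$, $$\sigma_n:=\inf\{t\ge\eta_n:\ X_t\in\partial\mathbb{G}_{\eta_n}\},\qquad \eta_{n+1}:=\inf\{t\ge\sigma_n:\ X_t\notin\partial\mathbb{G}_t\},$$ $$A_n:=\{\exists s\in[\eta_n,\sigma_n):\ X_s=0\},\qquad p_n:=\mathbb{P}(A_n\mid\mathcal{F}_{\eta_n}),\qquad S:=\sum_n p_n .$$ (a) Almost surely on the event $\{S=\infty\}$, the sample path of $\{X_t\}$ is recurrent. (b) Conversely, if simple random walk on the fixed graph $\overline{\mathbb{G}}$ is transient, then almost surely on the event $\{S<\infty\}$, the sample path of $\{X_t\}$ is transient.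
   Context: Setting: $\overline{\mathbb{G}}$ is a given locally finite connected graph with a distinguished vertex $0$. $\{\mathbb{G}_t\}_{t\ge0}$ is a (possibly random) non-decreasing sequence of connected subgraphs of $\overline{\mathbb{G}}$, with $\mathbb{G}_t\uparrow\mathbb{G}_\infty\subseteq\overline{\mathbb{G}}$. The discrete-time simple random walk $\{X_t\}$ on $\{\mathbb{G}_t\}$ starts at $X_0=0$, is adapted to some filtration $\{\mathcal{F}_t\}$, and $\{\mathbb{G}_t\}$ is $\mathcal{F}_\cdot$-previsible; given $\mathcal{F}_t$ and $X_t=x$, the position $X_{t+1}$ is chosen uniformly among all neighbors of $x$ within $\mathbb{G}_t$. (The evolution of $\mathbb{G}_t$ may depend on the walk.) Standing assumption: $\mathbb{B}^{\overline{\mathbb{G}}}(0,1)\subset\mathbb{G}_0$, where $\mathbb{B}^{\overline{\mathbb{G}}}(z,r)$ is the closed ball of radius $r$ and center $z$ in the graph distance of $\overline{\mathbb{G}}$; in particular all edges of $\overline{\mathbb{G}}$ at $0$ are in $\mathbb{G}_0$. The boundary set of $\mathbb{G}_t$ is $\partial\mathbb{G}_t:=\{z\in\mathbb{G}_t:\ \deg_{\mathbb{G}_t}(z)<\deg_{\overline{\mathbb{G}}}(z)\}$, with $\deg_{\mathbb{G}}(z)$ the degree of $z$ in $\mathbb{G}$. The sample path is called recurrent if $X_t=0$ for infinitely many $t$, and transient otherwise. Convention: $\inf\emptyset=\infty$, and if $\eta_n=\infty$ then $A_n=\emptyset$ and $p_n=0$. *)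

(* Defs.v *)
From HB Require Import structures.
From mathcomp Require Import all_boot all_order all_algebra finmap.
From mathcomp Require Import all_classical all_reals all_analysis.

Set Implicit Arguments.
Unset Strict Implicit.
Unset Printing Implicit Defensive.

Import Order.TTheory GRing.Theory Num.Theory.

Local Open Scope classical_set_scope.
Local Open Scope ring_scope.

Section Graphs.
Variable V : choiceType.

Record sgraph := SGraph {
  adj :> rel V;
  adj_sym : symmetric adj;
  adj_irr : irreflexive adj }.

(* Subgraphs are not assumed to be induced. *)
Record subgraph (Gbar : sgraph) := Subgraph {
  verts : set V;
  edge : rel V;
  edge_sym : symmetric edge;
  edge_verts : forall x y, edge x y -> verts x;
  edge_sub : forall x y, edge x y -> Gbar x y }.

Definition full (Gbar : sgraph) : subgraph Gbar :=
  @Subgraph Gbar [set: V] (adj Gbar) (adj_sym Gbar) (fun _ _ _ => I)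
    (fun _ _ e => e).

Definition locally_finite (Gbar : sgraph) : Prop :=
  forall x, finite_set [set y | Gbar x y].

(* Closed ball in the graph distance: the vertices joined to [x] by a path
   with at most [r] edges. *)
Definition gball (Gbar : sgraph) (x : V) (r : nat) : set V :=
  [set y | exists q : seq V,
    [/\ path (adj Gbar) x q, last x q = y & (size q <= r)%N]].

Section Subgraphs.
Variable Gbar : sgraph.
Implicit Types H K : subgraph Gbar.

Definition graph_connected H : Prop :=
  forall x y, verts H x -> verts H y ->
    exists2 q : seq V, path (edge H) x q & last x q = y.

Definition subgraph_le H K : Prop :=
  verts H `<=` verts K /\ (forall x y, edge H x y -> edge K x y).

(* [fset_set] is junk on infinite sets; degrees are only meaningful when
   [Gbar] is locally finite. *)
Definition deg H (x : V) : nat := #|` fset_set [set y | edge H x y]|%fset.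

Definition boundary H : set V :=
  [set z | verts H z /\ (deg H z < deg (full Gbar) z)%N].

End Subgraphs.
End Graphs.

(* Random times take values in [option nat], [None] standing for infinity. *)
Definition first_time (Q : set nat) : option nat :=
  match pselect (exists t, `[< Q t >]) with
  | left h => Some (ex_minn h)
  | right _ => None
  end.

Section Probability.
Context {R : realType} {d : measure_display} {Omega : measurableType d}.
Implicit Types (P : probability Omega R) (F : nat -> set (set Omega)).

Definition filtration F : Prop :=
  (forall t, sigma_algebra [set: Omega] (F t)) /\
  (forall t, F t `<=` measurable) /\
  (forall t, F t `<=` F t.+1).

Definition stopped_sigma F (tau : Omega -> option nat) : set (set Omega) :=
  [set B | measurable B /\ forall t,
    F t (B `&` [set w | exists2 s, tau w = Some s & (s <= t)%N])].

(* [q] is a version of the conditional probability of [A] given the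
   sub-sigma-algebra [E]. *)
Definition cond_prob P (E : set (set Omega)) (A : set Omega) (q : Omega -> R)
    : Prop :=
  [/\ forall B : set R, measurable B -> E (q @^-1` B),
      P.-integrable [set: Omega] (EFin \o q) &
      forall B, E B -> (\int[P]_(w in B) (q w)%:E = P (A `&` B))%E].

Section Walk.
Variables (V : choiceType) (Gbar : sgraph V).
Implicit Types (G : nat -> Omega -> subgraph Gbar) (X : nat -> Omega -> V).

(* [V] is countable whenever [Gbar] is connected and locally finite, so these
   events generate the relevant sigma-algebras. *)
Definition graph_measurable (E : set (set Omega)) (H : Omega -> subgraph Gbar)
    : Prop :=
  (forall x, E [set w | verts (H w) x]) /\
  (forall x y, E [set w | edge (H w) x y]).

Definition vertex_measurable (E : set (set Omega)) (Y : Omega -> V) : Prop :=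
  forall x, E [set w | Y w = x].

(* The initial graph, for which there is no earlier sigma-algebra, is only
   required to be measurable at time 0. *)
Definition previsible F G : Prop :=
  graph_measurable (F 0%N) (G 0%N) /\
  forall t, graph_measurable (F t) (G t.+1).

Definition step_prob (H : subgraph Gbar) (x y : V) : R :=
  if edge H x y then (deg H x)%:R^-1 else 0.

Record srw P F G (o : V) X : Prop := SRW {
  srw_filtration : filtration F;
  srw_previsible : previsible F G;
  srw_adapted : forall t, vertex_measurable (F t) (X t);
  srw_start : forall w, X 0%N w = o;
  srw_step : forall t y,
    cond_prob P (F t) [set w | X t.+1 w = y]
      (fun w => step_prob (G t w) (X t w) y) }.

(* The last two fields express that the unit ball around [o] is contained in
   the initial graph, including the edges at [o]. *)
Record growing_graphs G (o : V) : Prop := GrowingGraphs {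
  growing_connected : forall t w, graph_connected (G t w);
  growing_le : forall t w, subgraph_le (G t w) (G t.+1 w);
  growing_ball : forall w, gball Gbar o 1 `<=` verts (G 0%N w);
  growing_edges : forall w y, Gbar o y -> edge (G 0%N w) o y }.

Definition next_sigma G X (w : Omega) (e : option nat) : option nat :=
  if e is Some u
  then first_time [set t | (u <= t)%N /\ boundary (G u w) (X t w)]
  else None.

Definition next_eta G X (w : Omega) (s : option nat) : option nat :=
  if s is Some u
  then first_time [set t | (u <= t)%N /\ ~ boundary (G t w) (X t w)]
  else None.

Fixpoint eta_time G X (n : nat) (w : Omega) : option nat :=
  if n is m.+1 then next_eta G X w (next_sigma G X w (eta_time G X m w))
  else Some 0%N.

Definition sigma_time G X (n : nat) (w : Omega) : option nat :=
  next_sigma G X w (eta_time G X n w).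

(* The visit event is empty when [eta_time] is infinite, so every version of
   its conditional probability vanishes almost surely there. *)
Definition visit G X (o : V) (n : nat) : set Omega :=
  [set w | exists s : nat,
    [/\ exists2 u, eta_time G X n w = Some u & (u <= s)%N,
        forall v, sigma_time G X n w = Some v -> (s < v)%N &
        X s w = o]].

Definition recurrent X (o : V) (w : Omega) : Prop :=
  infinite_set [set t | X t w = o].

Definition transient X (o : V) (w : Omega) : Prop := ~ recurrent X o w.

End Walk.
End Probability.

(* The law of the simple random walk on [Gbar] started at [o] is unique, so it
   does not matter which realization of it is considered. *)
Definition transient_graph (R : realType) (V : choiceType) (Gbar : sgraph V)
    (o : V) : Prop :=
  exists (d : measure_display) (Omega : measurableType d)
    (P : probability Omega R) (F : nat -> set (set Omega))
    (Y : nat -> Omega -> V),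
    srw P F (fun _ _ => full Gbar) o Y /\
    {ae P, forall w, transient Y o w}.

(* Main.v *)
(** Both parts rest on two independent facts.

    Conditional Borel-Cantelli: [p n] integrates to [P (A n `&` B)] over every
    [B] in the sigma-algebra at time [eta n].  Taking for [B] the event that no
    [A j] with [m <= j < n] has occurred makes the sets [A n `&` B] disjoint, so
    the sum of the [p n] restricted to [B] has expectation at most 1; hence a.s.
    [A n] occurs infinitely often where the [p n] have an infinite sum.  Taking
    for [B] the event [p 0 + ... + p n <= c] bounds the sum of the
    [P (A n `&` B)] by [c]; hence a.s. [A n] occurs finitely often where the
    sum is finite.

    Visits inside one interval [[eta n, sigma n)]: there the walk only meets
    vertices all of whose edges are already present, so it moves as the simple
    random walk on [Gbar], and its expected number of visits to [o] is at most
    the Green function of [Gbar].  The latter is bounded as soon as the return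
    probability to [o] is less than 1, and otherwise every visit of the simple
    random walk on [Gbar] to [o] is a.s. followed by another one.

    Finally [o] is never a boundary vertex, so every visit to [o] occurs in one
    of these intervals, the n-th of which starts no earlier than time [n]. *)

Require Import Defs.
From HB Require Import structures.
From mathcomp Require Import all_boot all_order all_algebra finmap lra.
From mathcomp Require Import all_classical all_reals all_analysis measurable_realfun.

Set Implicit Arguments.
Unset Strict Implicit.
Unset Printing Implicit Defensive.

Import Order.TTheory GRing.Theory Num.Theory.

Local Open Scope classical_set_scope.
Local Open Scope ring_scope.

(** * Sigma-algebras and locally finite graphs *)

Section SigmaAlgebra.
Variables (T : pointedType) (E : set (set T)).
Hypothesis sE : sigma_algebra [set: T] E.

(** A sigma-algebra generates itself, so [E] can be read as the measurable sets of a type, and their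
    closure properties apply to it. *)
Lemma sigma_algebra_measurable (A : set T) :
  E A = measurable (A : set (g_sigma_algebraType E)).
Proof. by rewrite /measurable/= (sigma_algebra_id sE). Qed.

Lemma sigma_algebra_not (A : T -> Prop) :
  E [set w | A w] -> E [set w | ~ A w].
Proof. by rewrite !sigma_algebra_measurable => /measurableC. Qed.

Lemma sigma_algebra_and (A B : T -> Prop) :
  E [set w | A w] -> E [set w | B w] -> E [set w | A w /\ B w].
Proof. by rewrite !sigma_algebra_measurable; exact: measurableI. Qed.

Lemma sigma_algebra_exists (I : choiceType) (A : I -> T -> Prop) :
  countable [set: I] -> (forall i, E [set w | A i w]) ->
  E [set w | exists i, A i w].
Proof.
move=> cI EA.
rewrite (_ : [set w | _] = \bigcup_i [set w | A i w]); last first.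
  by apply/seteqP; split=> [w [i Aw]|w [i _ Aw]]; exists i.
rewrite sigma_algebra_measurable.
by apply: countable_bigcupT_measurable => // i; rewrite -sigma_algebra_measurable.
Qed.

Lemma sigma_algebra_forall (I : choiceType) (A : I -> T -> Prop) :
  countable [set: I] -> (forall i, E [set w | A i w]) ->
  E [set w | forall i, A i w].
Proof.
move=> cI EA.
rewrite (_ : [set w | _] = [set w | ~ exists i, ~ A i w]).
  apply: sigma_algebra_not; apply: sigma_algebra_exists => // i.
  exact: sigma_algebra_not.
apply/seteqP; split=> [w Aw [i /(_ (Aw i))]//|w nA i].
by apply: contra_notP nA => ?; exists i.
Qed.

Lemma sigma_algebra_cst (Q : Prop) : E [set w | Q].
Proof.
have sET : E setT by rewrite sigma_algebra_measurable; exact: measurableT.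
have [q|nq] := pselect Q.
- by have -> : [set w : T | Q] = setT by apply/seteqP; split.
- have -> : [set w : T | Q] = [set w | ~ setT w].
    by apply/seteqP; split=> w //= /(_ Logic.I).
  exact: sigma_algebra_not.
Qed.

(** [Q] is deterministic, in practice an inequality [s <= t] between times; it may be assumed while
    proving membership, which makes the inclusion of [F s] in [F t] available. *)
Lemma sigma_algebra_cst_and (Q : Prop) (A : T -> Prop) :
  (Q -> E [set w | A w]) -> E [set w | Q /\ A w].
Proof.
case: (pselect Q) => [q /(_ q)|nq _]; first exact/sigma_algebra_and/sigma_algebra_cst.
rewrite (_ : [set w | _] = [set w | False]); first exact: sigma_algebra_cst.
by apply/seteqP; split=> w [].
Qed.

Lemma sigma_algebra_cst_imp (Q : Prop) (A : T -> Prop) :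
  (Q -> E [set w | A w]) -> E [set w | Q -> A w].
Proof.
case: (pselect Q) => [q /(_ q)|nq _].
- by rewrite (_ : [set w | Q -> _] = [set w | A w])//; apply/seteqP; split=> w /=; [apply|].
- rewrite (_ : [set w | _] = [set w | True]); first exact: sigma_algebra_cst.
  by apply/seteqP; split=> w //= _ /nq.
Qed.

End SigmaAlgebra.

Lemma countable_nat : countable [set: nat].
Proof. exact: countableP. Qed.

Section Graph.
Variables (V : choiceType) (Gbar : sgraph V).
Hypothesis lf : locally_finite Gbar.
Implicit Types (H : subgraph Gbar).

(** The balls around [o] are finite by local finiteness, and they exhaust [V] by connectedness. *)
Lemma connected_countable (o : V) :
  graph_connected (full Gbar) -> countable [set: V].
Proof.
move=> conn.
pose ball := fix ball n : set V :=
  if n is m.+1 then \bigcup_(x in ball m) [set y | Gbar x y] else [set o].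
have fin n : finite_set (ball n).
  by elim: n => [|n IHn] /=; [exact: finite_set1|exact: bigcup_finite].
rewrite (_ : [set: V] = \bigcup_n ball n); last first.
  apply/seteqP; split=> // y _; have [//|//|q pq qy] := conn o y.
  exists (size q) => //; rewrite -{}qy.
  elim/last_ind: q pq => [_|q x IHq]; first by [].
  rewrite rcons_path last_rcons size_rcons => /andP[pq eq] /=.
  by exists (last o q); [exact: IHq|].
by apply: bigcup_countable => // n _; exact: finite_set_countable.
Qed.

Lemma finite_edges H x : finite_set [set y | edge H x y].
Proof. by apply: sub_finite_set (lf x) => y /= /edge_sub. Qed.

(** The edges of [H] at [z] are among the finitely many edges of [Gbar] at [z], so a smaller degree
    means a missing edge. Unlike degrees, missing edges are directly covered by
    [graph_measurable]. *)
Lemma boundaryE H z :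
  boundary H z <-> verts H z /\ exists y, Gbar z y /\ ~ edge H z y.
Proof.
have sub : (fset_set [set y | edge H z y] `<=`
            fset_set [set y | edge (full Gbar) z y])%fset.
  apply/fsubsetP => y; rewrite !in_fset_set; [|exact: finite_edges..].
  by rewrite !inE => /edge_sub.
rewrite /boundary /deg /=; split=> -[zH].
- move=> lt; split=> //; apply: contrapT => ne; move: lt; rewrite ltnNge => /negP; apply.
  apply: fsubset_leq_card; apply/fsubsetP => y.
  rewrite !in_fset_set; [|exact: finite_edges|exact: (lf z)].
  by rewrite !inE => zy; apply: contrapT => nzy; apply: ne; exists y.
- move=> [y [zy nzy]]; split=> //; apply: fproper_ltn_card; rewrite fproperE sub /=.
  apply/negP => /fsubsetP/(_ y); rewrite !in_fset_set; [|exact: finite_edges|exact: (lf z)].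
  by rewrite !inE => /(_ zy).
Qed.

Lemma subgraph_le_trans (G : nat -> subgraph Gbar) s t :
  (forall t, subgraph_le (G t) (G t.+1)) -> (s <= t)%N ->
  subgraph_le (G s) (G t).
Proof.
move=> inc /subnKC <-; elim: (t - s)%N => [|k [IHv IHe]]; first by rewrite addn0; split.
rewrite addnS; have [iv ie] := inc (s + k)%N.
by split=> [x /IHv /iv|x y /IHe /ie].
Qed.

End Graph.

Lemma first_time_SomeP (Q : set nat) t :
  first_time Q = Some t <-> Q t /\ forall r, (r < t)%N -> ~ Q r.
Proof.
rewrite /first_time; case: pselect => [h|nh]; last first.
  by split=> // -[Qt _]; exfalso; apply: nh; exists t; apply/asboolP.
case: ex_minnP => m /asboolP Qm minm; split=> [[<-]|[Qt mint]].
- by split=> // r rm Qr; move: rm; rewrite ltnNge minm//; apply/asboolP.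
- congr Some; apply/eqP; rewrite eqn_leq minm; last exact/asboolP.
  by rewrite leqNgt; apply/negP => /mint.
Qed.

Lemma first_time_None (Q : set nat) t : first_time Q = None -> ~ Q t.
Proof.
by rewrite /first_time; case: pselect => // nh _ Qt; apply: nh; exists t; apply/asboolP.
Qed.

(** * Conditional Borel-Cantelli lemma *)

Section ConditionalBorelCantelli.
Context {R : realType} {d : measure_display} {Omega : measurableType d}.
Variable P : probability Omega R.

(** The integral of [q] over the event [q < 0], which lies in [E], equals a probability; being
    nonnegative, it forces this event to be null. *)
Lemma cond_prob_ge0 (E : set (set Omega)) (A : set Omega) (q : Omega -> R) :
  E `<=` measurable -> cond_prob P E A q -> {ae P, forall w, 0 <= q w}.
Proof.
move=> Em [mq iq qA].
pose B := q @^-1` `]-oo, 0%R[%classic.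
have EB : E B by apply: mq; exact: measurable_itv.
have mB : measurable B by exact: Em.
have B0 w : B w -> q w < 0 by rewrite /B/= in_itv.
have mqB : measurable_fun B (EFin \o q).
  by apply: measurable_funTS; exact: (measurable_int P iq).
have q0 : (\int[P]_(w in B) `|(q w)%:E| = 0)%E.
  apply/eqP; rewrite eq_le; apply/andP; split; last exact: integral_ge0.
  rewrite (eq_integral (fun w => - (q w)%:E)%E); last first.
    by move=> w; rewrite inE => /B0 qw /=; rewrite ltr0_norm.
  rewrite integralN ?qA ?oppe_le0 ?measure_ge0//.
  have iqB : P.-integrable B (EFin \o q) by exact: integrableS iq.
  exact: integrable_add_def.
move/(ae_eq_integral_abs P mB mqB) : q0; apply: filterS => w /= qw.
by rewrite leNgt; apply/negP => qw0; have := qw qw0 => -[]; apply/eqP; rewrite lt_eqF.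
Qed.

(** By monotone convergence the series has a finite integral, hence it is finite almost
    everywhere. *)
Lemma ae_nneseries_lty (f : nat -> Omega -> R) (B : nat -> set Omega) :
  (forall n, measurable_fun [set: Omega] (f n)) -> (forall n w, 0 <= f n w) ->
  (forall n, measurable (B n)) ->
  (\sum_(0 <= n <oo) \int[P]_(w in B n) (f n w)%:E < +oo)%E ->
  {ae P, forall w, (\sum_(0 <= n <oo) (((EFin \o f n) \_ (B n)) w) < +oo)%E}.
Proof.
move=> mf f0 mB fB.
have mfB n : measurable_fun setT ((EFin \o f n) \_ (B n)).
  apply: (measurable_restrictT _ (mB n)).1.
  by apply: measurable_funTS; apply/measurable_EFinP.
have fB0 n w : (0 <= ((EFin \o f n) \_ (B n)) w)%E.
  by apply: erestrict_ge0 => ? _ /=; rewrite lee_fin.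
have s0 w : (0 <= \sum_(0 <= n <oo) (((EFin \o f n) \_ (B n)) w))%E.
  exact: nneseries_ge0.
suff /integrable_ae : P.-integrable setT
    (fun w => \sum_(0 <= n <oo) (((EFin \o f n) \_ (B n)) w))%E.
  move=> /(_ measurableT); apply: filterS => w /(_ Logic.I).
  by rewrite ge0_fin_numE.
apply/integrableP; split; first exact: ge0_emeasurable_sum.
rewrite (eq_integral (fun w => \sum_(0 <= n <oo) (((EFin \o f n) \_ (B n)) w)))%E.
  rewrite integral_nneseries//.
  by under eq_eseriesr do rewrite -integral_mkcond.
by move=> w _; rewrite gee0_abs.
Qed.

Variables (E : nat -> set (set Omega)) (A : nat -> set Omega).
Variable p : nat -> Omega -> R.
Hypothesis sE : forall n, sigma_algebra [set: Omega] (E n).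
Hypothesis Em : forall n, E n `<=` measurable.
Hypothesis EE : forall n, E n `<=` E n.+1.
Hypothesis AE : forall n, E n.+1 (A n).
Hypothesis pA : forall n, cond_prob P (E n) (A n) (p n).

(** A version of a conditional probability may be negative on a null set; with the positive part all
    partial sums are monotone everywhere. *)
Let q n w := Num.max (p n w) 0.

Let q_ge0 n w : 0 <= q n w.
Proof. by rewrite le_max lexx orbT. Qed.

Let q_ae : {ae P, forall w n, q n w = p n w}.
Proof.
apply: ae_foralln => n; apply: filterS (cond_prob_ge0 (@Em n) (pA n)) => w.
by rewrite /q => /max_idPl.
Qed.

Let subE m n : (m <= n)%N -> E m `<=` E n.
Proof.
move=> /subnKC <-; elim: (n - m)%N => [|k IHk]; first by rewrite addn0.
by rewrite addnS; apply: subset_trans IHk _; exact: EE.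
Qed.

Let mp m n : (m <= n)%N ->
  measurable_fun [set: g_sigma_algebraType (E n)] (q m).
Proof.
move=> mn; apply: measurable_maxr => // _ Y mY; rewrite setTI.
rewrite -(sigma_algebra_measurable (sE n)); apply: (subE mn).
by have [+ _ _] := pA m; exact.
Qed.

Let mq n : measurable_fun [set: Omega] (q n).
Proof.
move=> _ Y mY; rewrite setTI; apply: (@Em n).
rewrite (sigma_algebra_measurable (sE n)) -[_ @^-1` _]setTI.
exact: mp.
Qed.

Let int_q n B : E n B -> (\int[P]_(w in B) (q n w)%:E = P (A n `&` B))%E.
Proof.
move=> EB; have [_ iq <- //] := pA n; apply: ae_eq_integral.
- exact: Em EB.
- by apply: measurable_funTS; apply/measurable_EFinP.
- by apply: measurable_funTS; exact: (measurable_int P iq).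
- by apply: filterS q_ae => w qw _; rewrite qw.
Qed.

Lemma cond_borel_cantelli_infinite :
  {ae P, forall w, (\sum_(0 <= n <oo) (p n w)%:E = +oo)%E ->
    forall m, exists2 n, (m <= n)%N & A n w}.
Proof.
(* Only [A j] with [j < n] enter, and these lie in [E n]. Intersected with [A n], the event says
   that [n] is the first index from [m] on at which [A] occurs, whence disjointness in [n]. *)
pose B m n := [set w | (m <= n)%N /\ forall j, (m <= j < n)%N -> ~ A j w].
have EB m n : E n (B m n).
  apply: sigma_algebra_and => //; first exact: sigma_algebra_cst.
  apply: (sigma_algebra_forall (sE n) countable_nat) => j.
  apply: (sigma_algebra_cst_imp (sE n)) => /andP[_ jn].
  by apply: sigma_algebra_not => //; exact: (subE jn).
have mB m n : measurable (B m n) by exact: Em (EB _ _).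
have mA n : measurable (A n) by exact: Em (AE n).
have sumB m : (\sum_(0 <= n <oo) \int[P]_(w in B m n) (q n w)%:E < +oo)%E.
  under eq_eseriesr do rewrite int_q//.
  rewrite -(eq_eseriesl (P := fun n => n \in [set: nat])); last first.
    by move=> n; rewrite in_setT.
  rewrite -measure_bigcup; [|by move=> n _; exact: measurableI|].
    apply: le_lt_trans (ltry 1); apply: probability_le1.
    by apply: bigcup_measurable => n _; exact: measurableI.
  move=> i j _ _ [w [[Ai [mi Bi]] [Aj [mj Bj]]]].
  case: (ltngtP i j) => // ij; exfalso.
  - by apply: (Bj i) => //; rewrite mi.
  - by apply: (Bi j) => //; rewrite mj.
have := ae_foralln (fun m => ae_nneseries_lty mq q_ge0 (mB m) (sumB m)).
apply: filterS2 q_ae => w qw fin sumoo m.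
(* If no [A n] with [m <= n] occurred, [w] would lie in [B m n] for all these [n]. The restricted
   series would then share its tail with the divergent one, whose first [m] terms are finite. *)
apply: contrapT => nA; have := fin m; rewrite ltNge => /negP; apply.
rewrite leye_eq.
have Bw n : (m <= n)%N -> B m n w.
  by move=> mn; split=> // j /andP[mj _] Aj; apply: nA; exists j.
have patch0 n : (0 <= ((EFin \o q n) \_ (B m n)) w)%E.
  by apply: erestrict_ge0 => ? _ /=; rewrite lee_fin.
have q0 n : (0 <= (q n w)%:E)%E by rewrite lee_fin.
move: sumoo; under eq_eseriesr do rewrite -qw.
rewrite (nneseries_split 0 m)// add0n sumEFin -nneseries_addn//.
rewrite (eq_eseriesr (g := fun i => ((EFin \o q (i + m)%N) \_ (B m (i + m)%N)) w)).
  rewrite (@nneseries_addn _ (fun i => ((EFin \o q i) \_ (B m i)) w) m)// => sumoo.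
  rewrite (nneseries_split 0 m)// add0n; move: sumoo.
  case: (\sum_(m <= k <oo) _)%E => //= _.
  rewrite addey// -ltNye; apply: lt_le_trans (ltNyr 0) _.
  exact: sume_ge0.
by move=> i _; rewrite patchE mem_set//; exact: Bw (leq_addl _ _).
Qed.


Lemma cond_borel_cantelli_finite :
  {ae P, forall w, (\sum_(0 <= n <oo) (p n w)%:E < +oo)%E ->
    exists m, forall n, (m <= n)%N -> ~ A n w}.
Proof.
(* The sum includes the term of index [n], which is already measurable for [E n]; a bound on the
   restricted sums therefore needs no correction for the last term. *)
pose B (c n : nat) := [set w | \sum_(j < n.+1) q j w <= c%:R].
have EB c n : E n (B c n).
  have mS : measurable_fun [set: g_sigma_algebraType (E n)]
      (fun w => \sum_(j < n.+1) q j w).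
    by apply: measurable_sum => j; apply: mp; rewrite -ltnS.
  rewrite (_ : B c n = setT `&` (fun w => \sum_(j < n.+1) q j w) @^-1` `]-oo, (c%:R : R)]).
    by rewrite (sigma_algebra_measurable (sE n)); apply: mS => //; exact: measurable_itv.
  by rewrite setTI; apply/seteqP; split=> w; rewrite /B/= in_itv.
have mB c n : measurable (B c n) by exact: Em (EB _ _).
have mA n : measurable (A n) by exact: Em (AE n).
have mqB c n : measurable_fun setT ((EFin \o q n) \_ (B c n)).
  apply: (measurable_restrictT _ (mB c n)).1.
  by apply: measurable_funTS; apply/measurable_EFinP.
have patch0 c n w : (0 <= ((EFin \o q n) \_ (B c n)) w)%E.
  by apply: erestrict_ge0 => ? _ /=; rewrite lee_fin.
have sum_le c N w :
    (\sum_(0 <= n < N) ((EFin \o q n) \_ (B c n)) w <= (c%:R : R)%:E)%E.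
  (* If [B c N] holds at [w], the unrestricted sum is at most [c]; otherwise the last term vanishes
     and the induction hypothesis applies. *)
  elim: N => [|N IHN]; first by rewrite big_nil lee_fin.
  have [BN|BN] := pselect (B c N w); last first.
    by rewrite big_nat_recr//= [in X in (_ + X)%E]patchE memNset// adde0.
  apply: (@le_trans _ _ (\sum_(j < N.+1) q j w)%:E); last by rewrite lee_fin.
  rewrite big_mkord -sumEFin; apply: lee_sum => j _.
  by rewrite patchE; case: ifPn => //= _; rewrite lee_fin.
have sumAB c : (\sum_(0 <= n <oo) P (A n `&` B c n) < +oo)%E.
  under eq_eseriesr do rewrite -int_q// integral_mkcond.
  rewrite -integral_nneseries//.
  apply: (@le_lt_trans _ _ (\int[P]_w (c%:R : R)%:E)%E).
    apply: ge0_le_integral => //.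
    - by move=> w _; exact: nneseries_ge0.
    - exact: ge0_emeasurable_sum.
    - by move=> w _; apply: lime_le; [exact: is_cvg_nneseries|exact: nearW].
  rewrite integral_cst//.
  apply: (le_lt_trans (lee_wpmul2l _ (probability_le1 P measurableT))).
  - by rewrite lee_fin.
  - by rewrite mule1 ltry.
(* The ordinary Borel-Cantelli lemma, for each integer [c]; a finite sum at [w] is below some [c],
   and then [w] lies in every [B c n]. *)
have limsup c : P (lim_sup_set (fun n => A n `&` B c n)) = 0%E.
  by apply: lim_sup_set_cvg0 (sumAB c) => n; exact: measurableI.
have : {ae P, forall w c, ~ lim_sup_set (fun n => A n `&` B c n) w}.
  apply: ae_foralln => c; exists (lim_sup_set (fun n => A n `&` B c n)); split.
  - apply: bigcap_measurable => // n _; apply: bigcup_measurable => k _.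
    exact: measurableI.
  - exact: limsup.
  - by move=> w /= /contrapT.
apply: filterS2 q_ae => w qw fin sumlty.
have q0 n : (0 <= (q n w)%:E)%E by rewrite lee_fin.
have [c sumc] : exists c : nat, forall n, B c n w.
  move: sumlty; under eq_eseriesr do rewrite -qw.
  have S0 : (0 <= \sum_(0 <= k <oo) (q k w)%:E)%E by exact: nneseries_ge0.
  have Sge n := nneseries_lim_ge (m := 0) (P := xpredT) n (fun k _ _ => q0 k).
  move: S0 Sge; case: (\sum_(0 <= k <oo) _)%E => // r r0 Sge _.
  exists (Num.truncn r).+1 => n; rewrite /B/=.
  have := Sge n.+1; rewrite big_mkord sumEFin lee_fin => /le_trans; apply.
  exact/ltW/truncnS_gt.
apply: contrapT => nA; apply: (fin c) => m _.
apply: contrapT => nAB; apply: nA; exists m => n mn An.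
by apply: nAB; exists n.
Qed.

End ConditionalBorelCantelli.

(** * Green function and the Markov property *)

Section Kernel.
Variables (R : realType) (V : choiceType) (Gbar : sgraph V) (o : V).
Hypothesis lf : locally_finite Gbar.

Let kernel (x y : V) : R := step_prob (full Gbar) x y.
Let nbrs (x : V) := fset_set [set y | Gbar x y].

Lemma step_prob_ge0 (H : subgraph Gbar) x y : 0 <= (step_prob H x y : R).
Proof. by rewrite /step_prob; case: ifP. Qed.

(** The transition operator of the simple random walk on [Gbar], acting on functions. *)
Definition walk_op (h : V -> R) (x : V) : R :=
  \sum_(y <- nbrs x) kernel x y * h y.

Lemma walk_op_le (h h' : V -> R) x :
  (forall y, h y <= h' y) -> walk_op h x <= walk_op h' x.
Proof.
by move=> hh'; apply: ler_sum => y _; apply: ler_wpM2l => //; exact: step_prob_ge0.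
Qed.

Lemma walk_op_ge0 (h : V -> R) x : (forall y, 0 <= h y) -> 0 <= walk_op h x.
Proof.
move=> h0; apply: sumr_ge0 => y _.
by apply: mulr_ge0 => //; exact: step_prob_ge0.
Qed.

Lemma walk_opMr (h : V -> R) c x : walk_op (fun y => h y * c) x = walk_op h x * c.
Proof. by rewrite mulr_suml; apply: eq_bigr => y _; rewrite mulrA. Qed.

(** Only an inequality, because the left side is 0 at an isolated vertex. *)
Lemma walk_op1 x : walk_op (fun=> 1) x <= 1.
Proof.
rewrite /walk_op (eq_big_seq (fun=> (deg (full Gbar) x)%:R^-1)); last first.
  by move=> y; rewrite in_fset_set ?inE// => xy; rewrite /kernel /step_prob /= xy mulr1.
rewrite big_const_seq count_predT iter_addr_0 -[size _]/(deg (full Gbar) x).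
case: (deg _ x) => [|n]; first by rewrite mulr0n.
by rewrite -[leLHS]mulr_natr mulVf// pnatr_eq0.
Qed.

(* [hit n x] is the probability that the walk on [Gbar] from [x] visits [o]
   during [[1, n]], and [green n x] its expected number of visits to [o]
   during [[0, n)]. *)
Fixpoint hit (n : nat) : V -> R :=
  if n is m.+1 then walk_op (fun y => if y == o then 1 else hit m y) else fun=> 0.

Fixpoint green (n : nat) (x : V) : R :=
  if n is m.+1 then (x == o)%:R + walk_op (green m) x else 0.

Lemma hit_ge0 n x : 0 <= hit n x.
Proof.
by elim: n x => [|n IHn] x //=; apply: walk_op_ge0 => y; case: ifP.
Qed.

Lemma hit_le1 n x : hit n x <= 1.
Proof.
elim: n x => [|n IHn] x /=; first exact: ler01.
by apply: le_trans (walk_op1 x); apply: walk_op_le => y; case: ifP.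
Qed.

Lemma green_ge0 n x : 0 <= green n x.
Proof.
by elim: n x => [|n IHn] x //=; apply: addr_ge0; rewrite ?ler0n// walk_op_ge0.
Qed.

Lemma green_leS n x : green n x <= green n.+1 x.
Proof.
elim: n x => [|n IHn] x; first exact: green_ge0.
by rewrite /= lerD2l; exact: walk_op_le.
Qed.

(** Decomposition at the first visit to [o] after time 0: from there on, at most [green n o] visits
    are expected. *)
Lemma green_le_hit n x : green n x <= (x == o)%:R + hit n x * green n o.
Proof.
elim: n x => [|n IHn] x; first by rewrite /= mul0r addr0 ler0n.
(* The induction hypothesis yields the factor [green n o], which is at most [green n.+1 o]. *)
apply: (@le_trans _ _ ((x == o)%:R + hit n.+1 x * green n o)); last first.
  by rewrite lerD2l ler_wpM2l ?hit_ge0//; exact: green_leS.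
rewrite /= lerD2l -walk_opMr; apply: walk_op_le => y.
by have := IHn y; case: eqVneq => [->|_]; rewrite ?mul1r ?add0r.
Qed.

(** At [o] the decomposition reads [green n o <= 1 + f * green n o], which gives the geometric
    bound; any other start adds at most 1. *)
Lemma green_bounded f : f < 1 -> (forall n, hit n o <= f) ->
  forall n x, green n x <= 1 + (1 - f)^-1.
Proof.
move=> f1 hf.
have f1' : 0 < 1 - f by rewrite subr_gt0.
have go n : green n o <= (1 - f)^-1.
  have := green_le_hit n o; rewrite eqxx /= => h.
  rewrite -[leRHS]mul1r ler_pdivlMr// mulrBr mulr1 lerBlDr.
  apply: le_trans h _; rewrite lerD2l mulrC ler_wpM2l ?green_ge0//.
move=> n x; apply: le_trans (green_le_hit n x) _; apply: lerD; first by rewrite lern1 leq_b1.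
by apply: le_trans (go n); rewrite ler_piMl ?green_ge0 ?hit_le1.
Qed.

End Kernel.

Section CountableAe.
Context {R : realType} {d : measure_display} {Omega : measurableType d}.
Variable P : probability Omega R.

Lemma ae_forall_countable (I : choiceType) (Q : I -> Omega -> Prop) :
  countable [set: I] -> (forall i, {ae P, forall w, Q i w}) ->
  {ae P, forall w i, Q i w}.
Proof.
move=> /countable_injP[e inje] aeQ.
have : {ae P, forall w n i, e i = n -> Q i w}.
  apply: ae_foralln => n; have [[i ein]|ne] := pselect (exists i, e i = n).
    apply: filterS (aeQ i) => w Qi j ejn.
    by rewrite -(inje i j) ?inE// ein.
  by apply: aeW => w i ein; exfalso; apply: ne; exists i.
by apply: filterS => w Qw i; exact: Qw.
Qed.

End CountableAe.

(** * First-step estimates for a walk observed while it moves as on [Gbar] *)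

Section Markov.
Context {R : realType} {d : measure_display} {Omega : measurableType d}.
Variable P : probability Omega R.
Variables (V : choiceType) (Gbar : sgraph V) (o : V).
Hypothesis lf : locally_finite Gbar.
Hypothesis cV : countable [set: V].
Variables (F : nat -> set (set Omega)) (X : nat -> Omega -> V).
Hypothesis fF : filtration F.
Hypothesis X_adapted : forall t, vertex_measurable (F t) (X t).

Local Notation Pr A := (fine (P A)).

Let sF t : sigma_algebra setT (F t). Proof. by have [+ _] := fF; exact. Qed.
Let Fm t : F t `<=` measurable. Proof. by have [_ [+ _]] := fF; exact. Qed.

Lemma filtration_le s t : (s <= t)%N -> F s `<=` F t.
Proof.
have [_ [_ FS]] := fF.
move=> /subnKC <-; elim: (t - s)%N => [|k IHk]; first by rewrite addn0.
by rewrite addnS; apply: subset_trans IHk _.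
Qed.

Let mX t x : measurable [set w | X t w = x].
Proof. exact: Fm (X_adapted t x). Qed.

Lemma Pr_ge0 A : 0 <= Pr A.
Proof. by apply: fine_ge0. Qed.

Lemma Pr_le A B : measurable A -> measurable B -> A `<=` B -> Pr A <= Pr B.
Proof.
by move=> mA mB AB; rewrite fine_le ?fin_num_measure// le_measure ?inE.
Qed.

(* [D t] is an event on which the walk performs a step of the simple random
   walk on [Gbar] between times [t] and [t.+1]. *)
Variable D : nat -> set Omega.
Hypothesis FD : forall t, F t (D t).
Hypothesis DS : forall t, D t.+1 `<=` D t.
Hypothesis X_step : forall t x y B, F t B -> B `<=` D t ->
  B `<=` [set w | X t w = x] ->
  Pr (B `&` [set w | X t.+1 w = y]) = step_prob (full Gbar) x y * Pr B.

(** From [x] the walk almost surely steps to one of finitely many neighbours, the other vertices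
    having step probability 0. [C] need not belong to [F t], so it may describe later visits. *)
Lemma Pr_next t x B C : F t B -> B `<=` D t -> B `<=` [set w | X t w = x] ->
  measurable C -> C `<=` B ->
  Pr C = \sum_(y <- fset_set [set y | Gbar x y]) Pr (C `&` [set w | X t.+1 w = y]).
Proof.
move=> FB BD BX mC CB.
have mCX y : measurable (C `&` [set w | X t.+1 w = y]) by exact: measurableI.
have aeN : {ae P, forall w y, ~ Gbar x y -> ~ (C `&` [set w | X t.+1 w = y]) w}.
  apply: ae_forall_countable => // y.
  have [xy|xy] := pselect (Gbar x y); first exact: aeW.
  have mBy : measurable (B `&` [set w | X t.+1 w = y]).
    by apply: measurableI => //; exact: Fm FB.
  exists (B `&` [set w | X t.+1 w = y]); split=> //.
  - rewrite -(fineK (fin_num_measure P _ mBy)) (X_step y FB BD BX).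
    by rewrite /step_prob /= (negbTE (introN idP xy)) mul0r.
  - by move=> w /= /not_implyP[_ /contrapT[Cw Xw]]; split=> //; exact: CB.
rewrite (_ : P C = P (\bigcup_(y in [set y | Gbar x y]) (C `&` [set w | X t.+1 w = y]))).
  rewrite measure_fin_bigcup//; last first.
    by move=> y z _ _ [w [[_ <-] [_ <-]]].
  rewrite fsbig_finite//= sum_fine// => y _.
  by rewrite fin_num_measure.
set U := \bigcup_(y in _) _.
have mU : measurable U by apply: fin_bigcup_measurable => [|y _]; [exact: lf|exact: mCX].
rewrite (measureDI P mC mU) setIC setIidl; last by move=> w [y _ []].
rewrite [X in (X + _)%E](_ : _ = 0%E) ?add0e//.
apply: measure_negligible; first exact: measurableD.
apply: negligibleS aeN => w [Cw nUw] /= Nw.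
apply: nUw; exists (X t.+1 w) => //=; apply: contrapT => /Nw; exact.
Qed.

(** First-step induction along the recursion of [green]. Visits outside [D] are not counted, hence
    an inequality. *)
Lemma Pr_green_le N t x B : F t B -> B `<=` [set w | X t w = x] ->
  \sum_(k < N) Pr (B `&` (D (t + k)%N `&` [set w | X (t + k)%N w = o])) <=
    green R Gbar o N x * Pr B.
Proof.
elim: N t x B => [|N IHN] t x B FB BX; first by rewrite big_ord0 mul0r.
have mB : measurable B by exact: Fm FB.
have mD s : measurable (D s) by exact: Fm (FD s).
rewrite big_ord_recl /= addn0 mulrDl; apply: lerD.
  case: eqVneq => [xo|/eqP xo].
    by rewrite mul1r; apply: Pr_le; [do 2 apply: measurableI => //|exact: mB|move=> w []].
  rewrite mul0r (_ : _ `&` _ = set0) ?measure0//.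
  by apply/seteqP; split=> // w [/BX /= Xx [_ /= Xo]]; apply: xo; rewrite -Xx.
(* The step law holds only inside [D t]; as [D] decreases, all the later visits that are counted
   already lie there. *)
pose B' := B `&` D t.
have FB' : F t B' by apply: sigma_algebra_and.
have B'X : B' `<=` [set w | X t w = x] by move=> w [/BX].
have B'D : B' `<=` D t by move=> w [].
have mB' : measurable B' by exact: Fm FB'.
have DSk s k : D (s + k)%N `<=` D s.
  by elim: k => [|k IHk]; rewrite ?addn0// addnS => w /DS /IHk.
under eq_bigr => k _.
  rewrite (@Pr_next t x B') //; last first.
  - move=> w [Bw [Dw _]]; split=> //; apply: DSk Dw.
  - by do 2 apply: measurableI => //.
  over.
rewrite exchange_big /=.
apply: (@le_trans _ _ (walk_op Gbar (green R Gbar o N) x * Pr B')); last first.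
  apply: ler_wpM2l; first by apply: walk_op_ge0 => y; exact: green_ge0.
  by apply: Pr_le => // w [].
rewrite mulr_suml; apply: ler_sum => y _.
apply: (@le_trans _ _ (green R Gbar o N y * Pr (B' `&` [set w | X t.+1 w = y]))).
  have FB'y : F t.+1 (B' `&` [set w | X t.+1 w = y]).
    by apply: (sigma_algebra_and (sF t.+1) (filtration_le (leqnSn t) FB')); exact: X_adapted.
  apply: le_trans (IHN t.+1 y _ FB'y _); last by move=> w [].
  apply: ler_sum => k _; rewrite /bump /= add1n addnS -addSn.
  apply: Pr_le.
  - by do 3 apply: measurableI => //.
  - by do 3 apply: measurableI => //.
  move=> w [[Bw [Dw Xw]] Xy]; split=> //; split=> //; split=> //.
  by apply/DS/DSk; exact: Dw.
by rewrite (X_step y FB' B'D B'X) mulrCA mulrA.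
Qed.

(** Borel-Cantelli for each starting vertex [x] separately. The start is random because the lemma
    serves for a walk observed from a later time on. *)
Lemma ae_finite_visits (C : R) : (forall N x, green R Gbar o N x <= C) ->
  {ae P, forall w, exists m, forall t, (m <= t)%N -> D t w -> X t w <> o}.
Proof.
move=> greenC.
have mA k : measurable (D k `&` [set w | X k w = o]).
  by apply: measurableI => //; exact: Fm (FD _).
have lim0 x : P (lim_sup_set (fun k => [set w | X 0%N w = x] `&`
    (D k `&` [set w | X k w = o]))) = 0%E.
  apply: lim_sup_set_cvg0 => [k|]; first exact: measurableI.
  apply: (@le_lt_trans _ _ (C * Pr [set w | X 0%N w = x])%:E); last exact: ltry.
  apply: lime_le; first exact: is_cvg_nneseries.
  apply: nearW => N; rewrite big_mkord -EFin_sum_fine => [|k _]; last first.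
    by rewrite fin_num_measure//; exact: measurableI.
  rewrite lee_fin; apply: le_trans (Pr_green_le N (X_adapted 0%N x) (@subset_refl _ _)) _.
  by rewrite ler_wpM2r// Pr_ge0.
have : {ae P, forall w x, ~ lim_sup_set (fun k => [set w | X 0%N w = x] `&`
    (D k `&` [set w | X k w = o])) w}.
  apply: ae_forall_countable => // x; eexists; split; [|exact: lim0|].
  - apply: bigcap_measurable => // n _; apply: bigcup_measurable => k _.
    exact: measurableI.
  - by move=> w /= /contrapT.
apply: filterS => w /(_ (X 0%N w)) nlim.
apply: contrapT => nm; apply: nlim => m _.
by apply: contrapT => nk; apply: nm; exists m => t mt Dt Xt; apply: nk; exists t.
Qed.

(** First-step induction along the recursion of [hit]: a step to [o] is already a return, and from
    any other vertex [N] steps remain. *)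
Lemma Pr_hit_le N t x B : (forall t, D t = setT) ->
  F t B -> B `<=` [set w | X t w = x] ->
  hit R Gbar o N x * Pr B <=
    Pr (B `&` [set w | exists2 k, (k < N)%N & X (t + k).+1 w = o]).
Proof.
move=> DT; elim: N t x B => [|N IHN] t x B FB BX; first by rewrite mul0r Pr_ge0.
have mB : measurable B by exact: Fm FB.
have mW s n : measurable [set w | exists2 k, (k < n)%N & X (s + k).+1 w = o].
  rewrite (_ : [set w | _] = \bigcup_(k in [set k | (k < n)%N]) [set w | X (s + k).+1 w = o]).
    by apply: bigcup_measurable.
  by apply/seteqP; split=> w [k]; exists k.
have BD : B `<=` D t by rewrite DT.
rewrite [leRHS](@Pr_next t x B)//; last exact: measurableI.
rewrite /= mulr_suml; apply: ler_sum => y _.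
rewrite -mulrA mulrCA -(X_step y FB BD BX).
have FBy : F t.+1 (B `&` [set w | X t.+1 w = y]).
  by apply: (sigma_algebra_and (sF t.+1) (filtration_le (leqnSn t) FB)); exact: X_adapted.
have mBy := Fm FBy.
case: eqVneq => [->|_].
  rewrite mul1r; apply: Pr_le; rewrite ?yo//.
  - exact: measurableI.
  - by do 2 apply: measurableI => //.
  - by move=> w [Bw Xw]; split=> //; split=> //; exists 0%N; rewrite ?addn0.
apply: le_trans (IHN t.+1 y _ FBy _) _; first by move=> w [].
apply: Pr_le.
- exact: measurableI.
- by do 2 apply: measurableI => //.
move=> w [[Bw Xw] [k kN Xk]]; split=> //; split=> //.
by exists k.+1; rewrite // addnS -addSn.
Qed.

End Markov.

(** * Simple random walk *)

Lemma finite_set_natP (A : set nat) :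
  finite_set A <-> exists M, forall s, A s -> (s < M)%N.
Proof.
split=> [/finite_seqP[s ->]|[M AM]]; last exact: sub_finite_set (finite_II M).
by exists (\max_(i <- s) i).+1 => i /= si; rewrite ltnS leq_bigmax_seq.
Qed.

Section SimpleRandomWalk.
Context {R : realType} {d : measure_display} {Omega : measurableType d}.
Variable P : probability Omega R.
Variables (V : choiceType) (Gbar : sgraph V) (o : V).
Hypothesis lf : locally_finite Gbar.
Hypothesis cV : countable [set: V].
Variables (F : nat -> set (set Omega)) (G : nat -> Omega -> subgraph Gbar).
Variable X : nat -> Omega -> V.
Hypothesis X_srw : srw P F G o X.

Let fF : filtration F := srw_filtration X_srw.
Let sF t : sigma_algebra setT (F t). Proof. by have [+ _] := fF; exact. Qed.
Let Fm t : F t `<=` measurable. Proof. by have [_ [+ _]] := fF; exact. Qed.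
Let FX t x : F t [set w | X t w = x]. Proof. exact: srw_adapted X_srw t x. Qed.

Lemma srw_graph_measurable s t : (s <= t)%N -> graph_measurable (F t) (G s).
Proof.
have [G0 GS] := srw_previsible X_srw.
suff Gs : graph_measurable (F s) (G s).
  by move=> st; have [Gv Ge] := Gs; split=> *; exact: (filtration_le fF st).
case: s => // s; have [Gv Ge] := GS s.
by split=> *; exact: (filtration_le fF (leqnSn s)).
Qed.

Lemma step_prob_full (H : subgraph Gbar) x y :
  (forall z, Gbar x z -> edge H x z) ->
  step_prob H x y = step_prob (full Gbar) x y :> R.
Proof.
move=> fullx; have eqx z : edge H x z = Gbar x z.
  by apply/idP/idP => [/edge_sub|/fullx].
rewrite /step_prob /= eqx /deg (_ : [set z | edge H x z] = [set z | Gbar x z])//.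
by apply/seteqP; split=> z /=; rewrite eqx.
Qed.

(** On [B] all edges of [Gbar] at [x] are present, so the conditional probability of the step is a
    constant there. *)
Lemma srw_Pr_step t x y (B : set Omega) : F t B ->
  (forall w, B w -> X t w = x /\ forall z, Gbar x z -> edge (G t w) x z) ->
  fine (P (B `&` [set w | X t.+1 w = y])) =
    step_prob (full Gbar) x y * fine (P B).
Proof.
move=> FB Bx; have [_ _ /(_ B FB) int] := srw_step X_srw t y.
rewrite setIC -int (eq_integral (cst (step_prob (full Gbar) x y : R)%:E)); last first.
  by move=> w; rewrite inE => /Bx[-> fullx] /=; rewrite step_prob_full.
rewrite integral_cst; last exact: Fm FB.
by rewrite fineM// fin_num_measure//; exact: Fm FB.
Qed.

(** For each of the countably many [y], the conditional probability of stepping to [y] vanishes on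
    the event that [y] is not currently a neighbour. *)
Lemma srw_ae_edge : {ae P, forall w t, edge (G t w) (X t w) (X t.+1 w)}.
Proof.
apply: ae_foralln => t.
suff : {ae P, forall w y, ~ (X t.+1 w = y /\ ~ edge (G t w) (X t w) y)}.
  apply: filterS => w nw; apply/negPn/negP => nedge.
  by apply: (nw (X t.+1 w)); split=> //; exact/negP.
apply: ae_forall_countable => // y.
pose B := [set w | ~ exists x, X t w = x /\ edge (G t w) x y].
have FB : F t B.
  apply: sigma_algebra_not => //; apply: sigma_algebra_exists => // x.
  by apply: sigma_algebra_and => //; exact: (srw_graph_measurable (leqnn t)).2.
have mB : measurable B by exact: Fm FB.
have mX : measurable [set w | X t.+1 w = y] by exact: Fm (FX _ _).
exists ([set w | X t.+1 w = y] `&` B); split.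
- exact: measurableI.
- have [_ _ <-//] := srw_step X_srw t y.
  apply: integral0_eq => w Bw; rewrite /step_prob; case: ifPn => // e.
  by exfalso; apply: Bw; exists (X t w).
- move=> w /= /contrapT[Xy ne]; split=> // -[x [Xx e]].
  by apply: ne; rewrite Xx.
Qed.

End SimpleRandomWalk.

Lemma transient_green_bounded (R : realType) (V : choiceType) (Gbar : sgraph V)
    (o : V) : locally_finite Gbar -> countable [set: V] ->
  transient_graph R Gbar o ->
  exists C : R, forall n x, green R Gbar o n x <= C.
Proof.
move=> lf cV [] d [] Omega [] P [] F [] Y [Y_srw trans].
have [[f f1 hitf]|nf] := pselect (exists2 f : R, f < 1 & forall n, hit R Gbar o n o <= f).
  by exists (1 + (1 - f)^-1); exact: green_bounded.
exfalso.
have fF := srw_filtration Y_srw.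
have [sF [Fm _]] := fF.
have FY t x : F t [set w | Y t w = x] by exact: srw_adapted Y_srw t x.
have mY t x : measurable [set w | Y t w = x] by exact: Fm (FY t x).
have step t x y B : F t B -> B `<=` setT -> B `<=` [set w | Y t w = x] ->
    fine (P (B `&` [set w | Y t.+1 w = y])) =
    step_prob (full Gbar) x y * fine (P B).
  by move=> FB _ BY; apply: (srw_Pr_step Y_srw y FB) => w /BY.
pose W t N := [set w | exists2 k, (k < N)%N & Y (t + k).+1 w = o].
have mW t N : measurable (W t N).
  rewrite (_ : W t N = \bigcup_(k in [set k | (k < N)%N]) [set w | Y (t + k).+1 w = o]).
    by apply: bigcup_measurable.
  by apply/seteqP; split=> w [k]; exists k.
(* On [U t] the visit at time [t] is the last one; the aim is that this has probability 0. *)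
pose U t := [set w | Y t w = o] `\` \bigcup_N W t N.
have mU t : measurable (U t).
  by apply: measurableD => //; exact: bigcup_measurable.
have U0 t : P (U t) = 0%E.
  rewrite -(fineK (fin_num_measure P _ (mU t))); congr EFin.
  apply/eqP; rewrite eq_le fine_ge0 ?measure_ge0// andbT.
  (* With [hit N o > 1 - e], at least the fraction [1 - e] of the event [Y t = o] returns within [N]
     steps, so [U t] has probability at most [e]. *)
  apply/ler_addgt0Pl => e e0; rewrite addr0.
  have [N hitN] : exists N, 1 - e < hit R Gbar o N o.
    apply: contrapT => nN; apply: nf; exists (1 - e); first by rewrite ltrBlDr ltrDl.
    by move=> n; rewrite leNgt; apply/negP => hn; apply: nN; exists n.
  pose B := [set w | Y t w = o].
  have mB : measurable B by exact: mY.
  have mBW : measurable (B `&` W t N) by exact: measurableI.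
  have le1 : fine (P B) <= 1.
    rewrite -lee_fin fineK; last exact: (fin_num_measure P _ (mY t o)).
    exact: (probability_le1 P (mY t o)).
  have := Pr_hit_le o lf cV fF (srw_adapted Y_srw) step N
    (fun=> erefl) (FY t o) (@subset_refl _ _).
  rewrite -/(W t N) -/B => hB.
  have UW : fine (P (U t)) + fine (P (B `&` W t N)) <= fine (P B).
    rewrite -fineD ?fin_num_measure//.
    have disj : U t `&` (B `&` W t N) = set0.
      by apply/seteqP; split=> // w [[_ nW] [_ Ww]]; apply: nW; exists N.
    rewrite -measureU//.
    by apply: (Pr_le P); [exact: measurableU|exact: mB|move=> w [[]|[]]].
  have B0 : 0 <= fine (P B) by exact: fine_ge0.
  nra.
have : {ae P, forall w t, ~ U t w}.
  apply: ae_foralln => t; exists (U t); split; [exact: mU|exact: U0|].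
  by move=> w /= /contrapT.
have Y0 w : Y 0%N w = o by exact: srw_start Y_srw w.
move=> nU.
(* Almost every path starts at [o], has no last visit there, and yet visits [o] only finitely often;
   so the whole space would be null. *)
have : {ae P, forall w, False}.
  apply: filterS2 trans nU => w trans nU; apply: trans => fin.
  have ret t : Y t w = o -> exists2 s, (t < s)%N & Y s w = o.
    move=> Yt; apply: contrapT => nr; apply: (nU t); split=> // -[N _ [k _ Yk]].
    by apply: nr; exists (t + k).+1 => //; rewrite ltnS leq_addr.
  have big m : exists2 s, (m <= s)%N & Y s w = o.
    elim: m => [|m [s ms /ret[r sr Yr]]]; first by exists 0%N.
    by exists r => //; exact: leq_ltn_trans sr.
  have [M ltM] := (finite_set_natP _).1 fin.
  have [s Ms Ys] := big M; have := ltM s Ys.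
  by rewrite ltnNge Ms.
move=> [N [mN N0 /= subN]]; have NT : N = setT.
  by apply/seteqP; split=> // w _; apply: subN.
have := probability_setT P; rewrite -NT N0 => /eqP.
by rewrite eq_sym onee_eq0.
Qed.

(** * The times [eta n] and [sigma n] *)

Lemma first_time_le (Q : set nat) t :
  Q t -> exists2 r, (r <= t)%N & first_time Q = Some r.
Proof.
case E : (first_time Q) => [r|] Qt; last by have := first_time_None E Qt.
exists r => //; have [_ min] := (first_time_SomeP _ _).1 E.
by rewrite leqNgt; apply/negP => /min.
Qed.

(** * Sigma-algebras stopped at a discrete random time *)

Section StoppedSigma.
Context {d : measure_display} {Omega : measurableType d}.
Variables (F : nat -> set (set Omega)).
Hypothesis fF : filtration F.
Implicit Types (tau : Omega -> option nat).

Let sF t : sigma_algebra setT (F t). Proof. by have [+ _] := fF; exact. Qed.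
Let Fm t : F t `<=` measurable. Proof. by have [_ [+ _]] := fF; exact. Qed.

Definition stopping_time tau := forall t, F t [set w | tau w = Some t].

(** Time is discrete, so events up to time [t] are finite unions of events at exact times. *)
Lemma stopped_sigmaP tau (B : set Omega) : stopping_time tau ->
  stopped_sigma F tau B <->
    measurable B /\ forall t, F t [set w | B w /\ tau w = Some t].
Proof.
move=> st; split=> -[mB FB]; split=> // t.
- rewrite (_ : [set w | _] =
    [set w | (B `&` [set w | exists2 s, tau w = Some s & (s <= t)%N]) w /\ tau w = Some t]).
    by apply: sigma_algebra_and.
  apply/seteqP; split=> w /=; last by move=> [[]].
  by move=> [Bw tw]; split=> //; split=> //; exists t.
- rewrite (_ : _ `&` _ = [set w | exists s, (s <= t)%N /\ (B w /\ tau w = Some s)]).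
    apply: (sigma_algebra_exists (sF _) countable_nat) => s.
    apply: sigma_algebra_cst_and => // st'.
    exact: (filtration_le fF st').
  apply/seteqP; split=> w /=; first by move=> [Bw [s ts le]]; exists s.
  by move=> [s [le [Bw ts]]]; split=> //; exists s.
Qed.

Lemma stopped_sigma_algebra tau : stopping_time tau ->
  sigma_algebra setT (stopped_sigma F tau).
Proof.
move=> st; split.
- apply/stopped_sigmaP => //; split=> // t; apply: sigma_algebra_and => //.
  exact: sigma_algebra_cst (sF t) False.
- move=> A /(stopped_sigmaP _ st)[mA FA]; rewrite setTD; apply/stopped_sigmaP => //.
  split=> [|t]; first exact: measurableC.
  rewrite (_ : [set w | _] = [set w | tau w = Some t /\ ~ (A w /\ tau w = Some t)]).
    by apply: sigma_algebra_and => //; apply: sigma_algebra_not.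
  apply/seteqP; split=> w [] => [nA tw|tw nA]; split=> //; first by move=> [].
  by move=> Aw; apply: nA.
- move=> A sA; apply/stopped_sigmaP => //; split=> [|t].
    by apply: bigcup_measurable => k _; have [] := sA k.
  rewrite (_ : [set w | _] = [set w | exists k, A k w /\ tau w = Some t]).
    apply: (sigma_algebra_exists (sF _) countable_nat) => k.
    by have /(stopped_sigmaP _ st)[_] := sA k.
  by apply/seteqP; split=> w [] => [[k _ Ak] tw|k [Ak tw]]; [exists k|split=> //; exists k].
Qed.

Lemma stopped_sigma_le tau tau' : stopping_time tau -> stopping_time tau' ->
  (forall w t, tau' w = Some t -> exists2 s, tau w = Some s & (s <= t)%N) ->
  stopped_sigma F tau `<=` stopped_sigma F tau'.
Proof.
move=> st st' le B [mB FB]; apply/stopped_sigmaP => //; split=> // t.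
rewrite (_ : [set w | _] =
    [set w | (B `&` [set w | exists2 s, tau w = Some s & (s <= t)%N]) w /\ tau' w = Some t]).
  by apply: sigma_algebra_and.
apply/seteqP; split=> w /=; last by move=> [[]].
by move=> [Bw tw]; split=> //; split=> //; exact: le.
Qed.

End StoppedSigma.

Section Times.
Context {R : realType} {d : measure_display} {Omega : measurableType d}.
Variable P : probability Omega R.
Variables (V : choiceType) (Gbar : sgraph V) (o : V).
Hypothesis lf : locally_finite Gbar.
Hypothesis cV : countable [set: V].
Variables (F : nat -> set (set Omega)) (G : nat -> Omega -> subgraph Gbar).
Variable X : nat -> Omega -> V.
Hypothesis G_growing : growing_graphs G o.
Hypothesis X_srw : srw P F G o X.

Let fF : filtration F := srw_filtration X_srw.
Let sF t : sigma_algebra setT (F t). Proof. by have [+ _] := fF; exact. Qed.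
Let Fm t : F t `<=` measurable. Proof. by have [_ [+ _]] := fF; exact. Qed.
Let FX t x : F t [set w | X t w = x]. Proof. exact: srw_adapted X_srw t x. Qed.

Local Notation eta := (eta_time G X).
Local Notation sigma := (sigma_time G X).

Lemma G_le s t w : (s <= t)%N -> subgraph_le (G s w) (G t w).
Proof. by apply: (@subgraph_le_trans _ _ (G^~ w)) => // r; exact: (growing_le G_growing). Qed.

(** All edges at [o] are present at time 0, and edges are never removed. *)
Lemma not_boundary_origin t w : ~ boundary (G t w) o.
Proof.
move=> /(boundaryE lf)[_ [y [oy]]]; apply.
by apply: (G_le w (leq0n t)).2; exact: (growing_edges G_growing).
Qed.

Lemma sigma_timeP n w s : sigma n w = Some s <->
  exists u, [/\ (u <= s)%N, eta n w = Some u, boundary (G u w) (X s w) &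
    forall r, (r < s)%N -> (u <= r)%N -> ~ boundary (G u w) (X r w)].
Proof.
rewrite /sigma_time; case: (eta n w) => [u|] /=; last by split=> // -[u []].
rewrite first_time_SomeP; split.
- by move=> [[us bs] min]; exists u; split=> // r rs ur br; exact: (min r).
- by move=> [u' [us [uu'] bs min]]; subst u'; split=> // r rs [ur]; exact: min.
Qed.

Lemma eta_timeSP n w t : eta n.+1 w = Some t <->
  exists s, [/\ (s <= t)%N, sigma n w = Some s, ~ boundary (G t w) (X t w) &
    forall r, (r < t)%N -> (s <= r)%N -> boundary (G r w) (X r w)].
Proof.
rewrite /= -/(sigma n w); case: (sigma n w) => [s|] /=; last by split=> // -[s []].
rewrite first_time_SomeP; split.
- move=> [[st bt] min]; exists s; split=> // r rt sr.
  by apply: contrapT => br; exact: (min r).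
- by move=> [s' [st [ss'] bt min]]; subst s'; split=> // r rt [sr]; apply; exact: min.
Qed.

Lemma eta_time_not_boundary n w u : eta n w = Some u -> ~ boundary (G u w) (X u w).
Proof.
case: n => [[<-]|n]; last by move=> /eta_timeSP[s []].
rewrite (srw_start X_srw); exact: not_boundary_origin.
Qed.

(** Strict, because at time [eta n] the walk is off the boundary of the current graph, while at time
    [sigma n] it is on the boundary of that same graph. *)
Lemma eta_timeS_lt n w t : eta n.+1 w = Some t ->
  exists2 u, eta n w = Some u & (u < t)%N.
Proof.
move=> /eta_timeSP[s [st /sigma_timeP[u [us eu bs _]] bt _]]; exists u => //.
apply: leq_trans st; rewrite ltn_neqAle us andbT; apply/eqP => us'.
by apply: eta_time_not_boundary eu _; rewrite [in X in boundary _ X]us'.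
Qed.

Lemma eta_time_ge n w u : eta n w = Some u -> (n <= u)%N.
Proof.
elim: n u => // n IHn u /eta_timeS_lt[s /IHn ns su].
exact: leq_ltn_trans su.
Qed.

(** Time [t] lies in the n-th interval; an infinite [sigma n] imposes no upper bound. *)
Definition alive n t w :=
  (exists2 u, eta n w = Some u & (u <= t)%N) /\
  (forall v, sigma n w = Some v -> (t < v)%N).

Lemma visit_alive n w : visit G X o n w <-> exists s, alive n s w /\ X s w = o.
Proof. by split=> [[s [es ss Xs]]|[s [[es ss] Xs]]]; exists s. Qed.

(** Otherwise [eta n <= t] for every [n]: as [t] is not in the n-th interval, [sigma n <= t], and
    [o] is off the boundary at time [t], so [eta n.+1 <= t]. This contradicts [n <= eta n]. *)
Lemma origin_alive t w : X t w = o -> exists n, alive n t w.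
Proof.
move=> Xt; apply: contrapT => nalive.
have early n : exists2 u, eta n w = Some u & (u <= t)%N.
  elim: n => [|n [u eu ut]]; first by exists 0%N.
  have [v sv vt] : exists2 v, sigma n w = Some v & (v <= t)%N.
    apply: contrapT => nv; apply: nalive; exists n; split; first by exists u.
    by move=> v sv; rewrite ltnNge; apply/negP => vt; apply: nv; exists v.
  rewrite /= -/(sigma n w) sv /=.
  have [|r rt ->] := @first_time_le
    [set t | (v <= t)%N /\ ~ boundary (G t w) (X t w)] t; last by exists r.
  by split=> //; rewrite Xt; exact: not_boundary_origin.
have [u /eta_time_ge tu ut] := early t.+1.
by have := leq_trans tu ut; rewrite ltnn.
Qed.

Lemma boundary_measurable s t : (s <= t)%N ->
  F t [set w | boundary (G s w) (X t w)].
Proof.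
move=> st; have [Gv Ge] := srw_graph_measurable X_srw st.
rewrite (_ : [set w | _] = [set w | exists x, X t w = x /\
    (verts (G s w) x /\ exists y, Gbar x y /\ ~ edge (G s w) x y)]).
  apply: sigma_algebra_exists => // x; apply: sigma_algebra_and => //.
  apply: sigma_algebra_and => //; apply: sigma_algebra_exists => // y.
  by apply: sigma_algebra_cst_and => // _; apply: sigma_algebra_not.
apply/seteqP; split=> w /=.
- by move=> /(boundaryE lf) b; exists (X t w).
- by move=> [x [<- b]]; apply/(boundaryE lf).
Qed.

Lemma sigma_time_stopping n : stopping_time F (eta n) -> stopping_time F (sigma n).
Proof.
move=> se s; rewrite (_ : [set w | _] = [set w | exists u, (u <= s)%N /\
    (eta n w = Some u /\ (boundary (G u w) (X s w) /\
     forall r, (r < s)%N -> (u <= r)%N -> ~ boundary (G u w) (X r w)))]).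
  apply: (sigma_algebra_exists (sF _) countable_nat) => u.
  apply: sigma_algebra_cst_and => // us; apply: sigma_algebra_and => //.
    exact: (filtration_le fF us).
  apply: sigma_algebra_and => //; first exact: boundary_measurable.
  apply: (sigma_algebra_forall (sF _) countable_nat) => r.
  apply: sigma_algebra_cst_imp => // rs; apply: sigma_algebra_cst_imp => // ur.
  apply: sigma_algebra_not => //; apply: (filtration_le fF (ltnW rs)).
  exact: boundary_measurable.
apply/seteqP; split=> w /=.
- by move=> /sigma_timeP[u [us eu bs min]]; exists u.
- by move=> [u [us [eu [bs min]]]]; apply/sigma_timeP; exists u.
Qed.

Lemma eta_time_stopping n : stopping_time F (eta n).
Proof.
elim: n => [|n /sigma_time_stopping ss] t.
  exact: (sigma_algebra_cst (sF t) (Some 0%N = Some t)).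
rewrite (_ : [set w | _] = [set w | exists s, (s <= t)%N /\
    (sigma n w = Some s /\ (~ boundary (G t w) (X t w) /\
     forall r, (r < t)%N -> (s <= r)%N -> boundary (G r w) (X r w)))]).
  apply: (sigma_algebra_exists (sF _) countable_nat) => s.
  apply: sigma_algebra_cst_and => // st; apply: sigma_algebra_and => //.
    exact: (filtration_le fF st).
  apply: sigma_algebra_and => //.
    by apply: sigma_algebra_not => //; exact: boundary_measurable.
  apply: (sigma_algebra_forall (sF _) countable_nat) => r.
  apply: sigma_algebra_cst_imp => // rt; apply: sigma_algebra_cst_imp => // sr.
  by apply: (filtration_le fF (ltnW rt)); exact: boundary_measurable.
apply/seteqP; split=> w /=.
- by move=> /eta_timeSP[s [st es bt min]]; exists s.
- by move=> [s [st [es [bt min]]]]; apply/eta_timeSP; exists s.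
Qed.

Lemma alive_measurable n t : F t [set w | alive n t w].
Proof.
rewrite (_ : [set w | _] = [set w | (exists u, (u <= t)%N /\ eta n w = Some u) /\
    (forall v, (v <= t)%N -> ~ sigma n w = Some v)]).
  apply: sigma_algebra_and => //.
    apply: (sigma_algebra_exists (sF _) countable_nat) => u.
    apply: sigma_algebra_cst_and => // ut; apply: (filtration_le fF ut).
    exact: eta_time_stopping.
  apply: (sigma_algebra_forall (sF _) countable_nat) => v.
  apply: sigma_algebra_cst_imp => // vt; apply: sigma_algebra_not => //.
  apply: (filtration_le fF vt); apply: sigma_time_stopping.
  exact: eta_time_stopping.
apply/seteqP; split=> w [eu sv]; split.
- by have [u] := eu; exists u.
- by move=> v vt /sv; rewrite ltnNge vt.
- by have [u []] := eu; exists u.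
- by move=> v ev; rewrite ltnNge; apply/negP => /sv.
Qed.

(** Visits in the n-th interval precede [sigma n], hence are known by time [eta n.+1], as the
    conditional Borel-Cantelli lemma requires. *)
Lemma visit_stopped n : stopped_sigma F (eta n.+1) (visit G X o n).
Proof.
have Fv s : F s [set w | alive n s w /\ X s w = o].
  by apply: sigma_algebra_and => //; exact: alive_measurable.
apply/stopped_sigmaP => //; first exact: eta_time_stopping.
split=> [|t].
  rewrite (_ : visit G X o n = \bigcup_s [set w | alive n s w /\ X s w = o]).
    by apply: bigcup_measurable => s _; exact: Fm (Fv s).
  apply/seteqP; split=> w; first by move=> /visit_alive[s]; exists s.
  by move=> [s _ asw]; apply/visit_alive; exists s.
rewrite (_ : [set w | _] = [set w | exists s, (s <= t)%N /\
    ((alive n s w /\ X s w = o) /\ eta n.+1 w = Some t)]).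
  apply: (sigma_algebra_exists (sF _) countable_nat) => s.
  apply: sigma_algebra_cst_and => // st; apply: sigma_algebra_and => //.
    exact: (filtration_le fF st).
  exact: eta_time_stopping.
apply/seteqP; split=> w /=.
- move=> [/visit_alive[s [asw Xs]] et]; exists s; split=> //.
  have /eta_timeSP[v [vt ev _ _]] := et.
  by apply: ltnW; apply: leq_trans vt; exact: asw.2.
- by move=> [s [st [asw et]]]; split=> //; apply/visit_alive; exists s.
Qed.

End Times.

(** * Visits to the origin within one interval *)

Section AliveVisits.
Context {R : realType} {d : measure_display} {Omega : measurableType d}.
Variable P : probability Omega R.
Variables (V : choiceType) (Gbar : sgraph V) (o : V).
Hypothesis lf : locally_finite Gbar.
Hypothesis cV : countable [set: V].
Variables (F : nat -> set (set Omega)) (G : nat -> Omega -> subgraph Gbar).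
Variable X : nat -> Omega -> V.
Hypothesis G_growing : growing_graphs G o.
Hypothesis X_srw : srw P F G o X.

Let fF : filtration F := srw_filtration X_srw.
Let sF t : sigma_algebra setT (F t). Proof. by have [+ _] := fF; exact. Qed.
Let FX t x : F t [set w | X t w = x]. Proof. exact: srw_adapted X_srw t x. Qed.

Local Notation eta := (eta_time G X).

Lemma srw_verts w : (forall t, edge (G t w) (X t w) (X t.+1 w)) ->
  forall t, verts (G t w) (X t w).
Proof.
move=> edgeX [|t].
  by rewrite (srw_start X_srw); apply: (growing_ball G_growing); exists [::].
apply: (G_le G_growing w (leqnSn t)).1.
by apply: (@edge_verts _ _ (G t w) _ (X t w)); rewrite edge_sym.
Qed.

(** Being off the boundary alone would not give all edges: a vertex outside the graph is never a
    boundary vertex. *)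
Let interior u t w := verts (G u w) (X t w) /\ ~ boundary (G u w) (X t w).

(** The walk uses edges of later graphs, but at an interior vertex of [G u] every edge of [Gbar] is
    in [G u], so the next vertex is in [G u] too, and it is off the boundary before [sigma n]. *)
Lemma alive_interior n u t w : (forall t, edge (G t w) (X t w) (X t.+1 w)) ->
  eta n w = Some u -> alive G X n t w ->
  forall r, (u <= r)%N -> (r <= t)%N -> interior u r w.
Proof.
move=> edgeX eu [_ sigma_gt].
have nb r : (u <= r)%N -> (r <= t)%N -> ~ boundary (G u w) (X r w).
  move=> ur rt br; have [|v vr sv] := @first_time_le
    [set t | (u <= t)%N /\ boundary (G u w) (X t w)] r; first by [].
  have : (t < v)%N by apply: sigma_gt; rewrite /sigma_time eu.
  by rewrite ltnNge (leq_trans vr rt).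
move=> r ur; rewrite -(subnKC ur); elim: (r - u)%N => [|k IHk] rt.
  by rewrite addn0 in rt *; split; [exact: srw_verts|exact: nb].
split; last by apply: nb => //; exact: leq_addr.
have [|vk bk] := IHk; first by apply: leq_trans rt; rewrite leq_add2l.
rewrite addnS; apply: (@edge_verts _ _ (G u w) _ (X (u + k)%N w)).
rewrite edge_sym; apply: contrapT => ne; apply: bk; apply/(boundaryE lf); split=> //.
by exists (X (u + k).+1 w); split=> //; exact: edge_sub (edgeX _).
Qed.

Lemma ae_finite_alive_visits n : transient_graph R Gbar o ->
  {ae P, forall w, exists m, forall t, (m <= t)%N -> alive G X n t w -> X t w <> o}.
Proof.
move=> /(transient_green_bounded lf cV)[C greenC].
(* [alive] implies interiority only for almost every path; building it into [D] makes the step law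
   hold surely. The value [u] of [eta n] is fixed to shift time by a constant. *)
pose D u k := [set w | eta n w = Some u /\
  forall r, (u <= r)%N -> (r <= u + k)%N -> interior u r w].
have Fint u r : (u <= r)%N -> F r [set w | interior u r w].
  move=> ur; apply: sigma_algebra_and => //; last first.
    by apply: sigma_algebra_not => //; exact: (boundary_measurable lf cV X_srw).
  rewrite (_ : [set w | _] = [set w | exists x, X r w = x /\ verts (G u w) x]).
    apply: sigma_algebra_exists => // x; apply: sigma_algebra_and => //.
    exact: (srw_graph_measurable X_srw ur).1.
  by apply/seteqP; split=> w /=; [exists (X r w)|move=> [x [<-]]].
have FD u k : F (u + k)%N (D u k).
  apply: sigma_algebra_and => //.
    apply: (filtration_le fF (leq_addr k u)).
    exact: (eta_time_stopping lf cV X_srw n).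
  apply: (sigma_algebra_forall (sF _) countable_nat) => r.
  apply: sigma_algebra_cst_imp => // ur; apply: sigma_algebra_cst_imp => // rk.
  by apply: (filtration_le fF rk); exact: Fint.
have DS u k : D u k.+1 `<=` D u k.
  by move=> w [eu Dw]; split=> // r ur rk; apply: Dw => //; rewrite addnS leqW.
have fFu u : filtration (fun k => F (u + k)%N).
  have [? [? FS]] := fF; split=> //; split=> // k; rewrite addnS; exact: FS.
have step u k x y B : F (u + k)%N B -> B `<=` D u k ->
    B `<=` [set w | X (u + k)%N w = x] ->
    fine (P (B `&` [set w | X (u + k.+1)%N w = y])) =
    step_prob (full Gbar) x y * fine (P B).
  move=> FB BD BX; rewrite addnS; apply: (srw_Pr_step X_srw y FB) => w Bw.
  split; first exact: BX.
  move=> z xz; have [_ /(_ (u + k)%N (leq_addr _ _) (leqnn _))[vX bX]] := BD _ Bw.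
  rewrite -(BX _ Bw); apply: (G_le G_growing w (leq_addr k u)).2.
  apply: contrapT => ne; apply: bX; apply/(boundaryE lf); split=> //.
  by exists z; split=> //; rewrite (BX _ Bw).
have := ae_foralln (fun u => ae_finite_visits lf cV (fFu u)
  (fun k => FX (u + k)%N) (FD u) (DS u) (step u) greenC).
apply: filterS2 (srw_ae_edge cV X_srw) => w edgeX fin.
case eu : (eta n w) => [u|]; last by exists 0%N => t _ [[u]]; rewrite eu.
have [m mfin] := fin u; exists (u + m)%N => t umt at_.
have ut : (u <= t)%N := leq_trans (leq_addr m u) umt.
rewrite -(subnKC ut); apply: mfin; first by rewrite leq_subRL.
by split=> // r ur; rewrite subnKC// => rt; exact: alive_interior eu at_ _ ur rt.
Qed.

End AliveVisits.

Theorem lemma1p3 (R : realType) (V : choiceType) (Gbar : sgraph V) (o : V)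
    (d : measure_display) (Omega : measurableType d) (P : probability Omega R)
    (F : nat -> set (set Omega)) (G : nat -> Omega -> subgraph Gbar)
    (X : nat -> Omega -> V) (p : nat -> Omega -> R)
    (Gbar_locally_finite : locally_finite Gbar)
    (Gbar_connected : graph_connected (full Gbar))
    (G_growing : growing_graphs G o)
    (X_srw : srw P F G o X)
    (p_cond_prob : forall n,
       cond_prob P (stopped_sigma F (eta_time G X n)) (visit G X o n) (p n)) :
  {ae P, forall w,
     (\sum_(0 <= n <oo) (p n w)%:E = +oo)%E -> recurrent X o w} /\
  (transient_graph R Gbar o ->
   {ae P, forall w,
      (\sum_(0 <= n <oo) (p n w)%:E < +oo)%E -> transient X o w}).
Proof.
have cV : countable [set: V] := connected_countable Gbar_locally_finite o Gbar_connected.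
have fF := srw_filtration X_srw.
have st n := eta_time_stopping Gbar_locally_finite cV X_srw n.
have sE n : sigma_algebra setT (stopped_sigma F (eta_time G X n)).
  exact: stopped_sigma_algebra.
have Em n : stopped_sigma F (eta_time G X n) `<=` measurable by move=> B [].
have EE n : stopped_sigma F (eta_time G X n) `<=` stopped_sigma F (eta_time G X n.+1).
  apply: stopped_sigma_le => // w t.
  move=> /(eta_timeS_lt Gbar_locally_finite G_growing X_srw)[s es st'].
  by exists s => //; exact: ltnW.
have AE n := visit_stopped Gbar_locally_finite cV X_srw n.
split=> [|trans].
- apply: filterS (cond_borel_cantelli_infinite sE Em EE AE p_cond_prob).
  move=> w inf /inf visits /finite_set_natP[M ltM].
  (* If [M] bounded all visit times, an occurrence of the n-th event with [n >= M] would give a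
     visit no earlier than [eta n >= n >= M]. *)
  have [n Mn /visit_alive[s [[[u eu us] _] Xs]]] := visits M.
  have := ltM s Xs; rewrite ltnNge (leq_trans Mn)//.
  apply: leq_trans us.
  exact: (eta_time_ge Gbar_locally_finite G_growing X_srw eu).
- have := ae_foralln (fun n =>
    ae_finite_alive_visits Gbar_locally_finite cV G_growing X_srw n trans).
  apply: filterS2 (cond_borel_cantelli_finite sE Em EE AE p_cond_prob).
  move=> w bc fin /bc[m nvisit]; apply; apply/finite_set_natP.
  (* Each of the finitely many intervals of index below [m] contains finitely many visits; the later
     ones contain none. *)
  have [M alive_lt] : exists M, forall n t, (n < m)%N ->
      alive G X n t w -> X t w = o -> (t < M)%N.
    elim: m {nvisit} => [|m [M ltM]]; first by exists 0%N.
    have [M' finM'] := fin m; exists (maxn M M') => n t.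
    rewrite ltnS leq_eqVlt => /orP[/eqP->|nm] at_ Xt; rewrite leq_max.
    + by apply/orP; right; rewrite ltnNge; apply/negP => /finM'; apply.
    + by rewrite (ltM n).
  exists M => t Xt.
  have [n an] := origin_alive Gbar_locally_finite G_growing X_srw Xt.
  apply: (alive_lt n) => //; rewrite ltnNge; apply/negP => mn.
  by apply: (nvisit n mn); apply/visit_alive; exists t.
Qed.
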